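(* For any graph $G$, any $l\in\mathbb{N}$, and any connected $H\in\mathcal{IIM}_l(G)$, we have $\operatorname{diam}(H)\le\max\{\operatorname{diam}(G),6\}$.
   Context: Graphs are finite, simple, undirected and nonempty. $N(v)$ is the neighborhood of $v$ and $N[v]=\{v\}\cup N(v)$. The Iterated Independent Model (IIM): Given a graph $G'$, one time step adds to $G'$, for every vertex $v \in V(G')$, exactly one new vertex $v'$ (the copy of $v$), which is, by a choice made independently for each $v$, either a clone of $v$, meaning $N(v')=N[v]$, or an anticlone of $v$, meaning $N(v')=V(G')\setminus N[v]$; here $N[v]$ is taken in $G'$, no edges are added among old vertices, and the vertices added in the same step are pairwise non-adjacent. $\mathcal{IIM}_l(G)$ is the set of all graphs obtainable from $G$ by $l$ successive time steps (over all choices), with $\mathcal{IIM}_0(G)=\{G\}$. $\operatorname{diam}(G)$ is the maximum distance between any pair of vertices of $G$, with the usual convention that vertices in different components are at distance $\infty$. *)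

(* Defs.v *)
From HB Require Import structures.
From mathcomp Require Import all_boot all_order all_algebra.
From mathcomp Require Import constructive_ereal.

Set Implicit Arguments.
Unset Strict Implicit.
Unset Printing Implicit Defensive.

Import Order.TTheory GRing.Theory Num.Theory.

Record sgraph := SGraph {
  vertex :> finType;
  adj : rel vertex;
  adj_sym : symmetric adj;
  adj_irr : irreflexive adj;
  vertex_gt0 : 0 < #|vertex|
}.

Definition nbhd (G : sgraph) (v : G) : {set G} := [set u | adj v u].

Definition cnbhd (G : sgraph) (v : G) : {set G} := v |: nbhd v.

Section Distance.

Variable G : sgraph.
Implicit Types u v : G.

Definition walk n u v : bool :=
  [exists p : n.-tuple G, path (@adj G) u p && (last u p == v)].

Lemma connect_walk u v : connect (@adj G) u v -> exists n, walk n u v.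
Proof.
case/connectP=> p up ->; exists (size p).
by apply/existsP; exists (in_tuple p); rewrite up eqxx.
Qed.

(* Distances take values in the naturals extended by +oo; they are embedded
   in [\bar int] in order to use the library's order on extended numbers. *)
Definition dist u v : \bar int :=
  if @idP (connect (@adj G) u v) is ReflectT uv
  then (Posz (ex_minn (connect_walk uv)))%:E
  else +oo%E.

(* The default -oo is neutral for max and irrelevant, as G is nonempty. *)
Definition diam : \bar int :=
  \big[Order.max/-oo%E]_(uv : G * G) dist uv.1 uv.2.

Definition connected_graph : Prop := forall u v, connect (@adj G) u v.

End Distance.

Section Step.

Variables (G : sgraph) (clone : pred G).

(* The neighborhood of the copy of v, which is a clone of v if [clone v]
   holds and an anticlone of v otherwise. *)
Definition copy_nbhd (v : G) : {set G} :=
  if clone v then cnbhd v else ~: cnbhd v.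

(* [inl v] is the old vertex v and [inr v] is its copy. *)
Definition step_adj : rel (G + G) := fun x y =>
  match x, y with
  | inl u, inl v => adj u v
  | inl u, inr v => u \in copy_nbhd v
  | inr u, inl v => v \in copy_nbhd u
  | inr _, inr _ => false
  end.

Lemma step_adj_sym : symmetric step_adj.
Proof. by case=> u [] v //=; rewrite adj_sym. Qed.

Lemma step_adj_irr : irreflexive step_adj.
Proof. by case=> u //=; rewrite adj_irr. Qed.

Lemma step_gt0 : 0 < #|{: G + G}|.
Proof. by rewrite card_sum addn_gt0 vertex_gt0. Qed.

Definition iim_step : sgraph := SGraph step_adj_sym step_adj_irr step_gt0.

End Step.

Inductive IIM (G : sgraph) : nat -> sgraph -> Prop :=
| IIM0 : IIM G 0 G
| IIMS l (G' : sgraph) (clone : pred G') :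
    IIM G l G' -> IIM G l.+1 (iim_step clone).

(* Main.v *)
Require Import Defs.
From mathcomp Require Import all_boot all_order all_algebra.
From mathcomp Require Import constructive_ereal.

(**
  It suffices to show that if one step turns [G] into a connected graph [H],
  then either [diam H <= 6], or [G] is connected and
  [diam H <= max (diam G) 6]: this can be iterated even though intermediate
  graphs may be disconnected.
  - If every copy is a clone, [H] projects onto [G], and walks of length at
    least 2 in [G] lift to [H] with arbitrary lifts of their end points.
  - If some anticlone [v'] is such that [N[v]] is not a union of components,
    then [v'] is at distance at most 3 from [v], and all vertices but some
    anticlones are either at distance at most 1 from [v] or at distance at
    most 2 from [v'].  The exceptions are the [w'] with
    [N[v] :|: N[w] = V(G)], for which [w] and [w'] play a similar role.
  - Otherwise, [N[v]] is a component of [G] for each anticlone [v'].  As [H] is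
    connected, there are anticlones of vertices of two different components,
    and a vertex [e] in a third one; every vertex of [H] is then at distance
    at most 3 from [e].
*)

Set Implicit Arguments.
Unset Strict Implicit.
Unset Printing Implicit Defensive.

Import Order.TTheory.

(** * Walks of bounded length *)

Section Within.

Variable G : sgraph.
Implicit Types u v w : G.

Definition within n u v : Prop :=
  exists2 p, path (@adj G) u p & last u p = v /\ size p <= n.

Lemma within_refl n u : within n u u.
Proof. by exists [::]. Qed.

Lemma within_adj u v : adj u v -> within 1 u v.
Proof. by move=> uv; exists [:: v]; rewrite //= uv. Qed.

Lemma within_le m n u v : m <= n -> within m u v -> within n u v.
Proof. by move=> mn [p pp [lp sp]]; exists p => //; split=> //; exact: leq_trans mn. Qed.

Lemma within_trans m n u v w :
  within m u v -> within n v w -> within (m + n) u w.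
Proof.
move=> [p pp [<- sp]] [q qq [<- sq]]; exists (p ++ q).
  by rewrite cat_path pp.
by rewrite last_cat size_cat leq_add.
Qed.

Lemma within_sym n u v : within n u v -> within n v u.
Proof.
move=> [p pp [<- sp]]; exists (rev (belast u p)).
  by rewrite rev_path (eq_path (e' := @adj G)) // => x y; rewrite adj_sym.
split; last by rewrite size_rev size_belast.
by case: p {pp sp} => //= x p; rewrite rev_cons last_rcons.
Qed.

Lemma within_cnbhd u v : v \in cnbhd u -> within 1 u v.
Proof.
rewrite !inE => /orP [/eqP -> | /within_adj //].
exact: within_refl.
Qed.

Lemma dist_connect u v (uv : connect (@adj G) u v) :
  dist u v = (Posz (ex_minn (connect_walk uv)))%:E.
Proof.
(* Generalizing only the index of [reflect] makes the case analysis on [idP] well typed. *)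
rewrite /dist; move: (@idP (connect _ u v)); move: {2}(connect _ u v).
by move=> _ [uv'|[]//]; rewrite (bool_irrelevance uv' uv).
Qed.

Lemma dist_le n u v : within n u v -> (dist u v <= (Posz n)%:E)%E.
Proof.
move=> [p pp [lp sp]].
have uv : connect (@adj G) u v by apply/connectP; exists p.
rewrite (dist_connect uv); case: ex_minnP => m _ m_min; rewrite lee_fin lez_nat.
apply: leq_trans sp; apply: m_min.
by apply/existsP; exists (in_tuple p); rewrite pp lp eqxx.
Qed.

Lemma within_dist u v :
  connect (@adj G) u v -> exists2 n, within n u v & dist u v = (Posz n)%:E.
Proof.
move=> uv; rewrite (dist_connect uv).
case: ex_minnP => m /existsP [p /andP [pp /eqP lp]] _.
by exists m => //; exists p => //; rewrite size_tuple.
Qed.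

Lemma diam_le (M : \bar int) : (forall u v, dist u v <= M)%E -> (diam G <= M)%E.
Proof. by move=> le_M; apply: bigmax_le => [|uv _]; [exact: leNye | exact: le_M]. Qed.

Lemma dist_le_diam u v : (dist u v <= diam G)%E.
Proof. exact: (le_bigmax _ (fun uv : G * G => dist uv.1 uv.2) (u, v)). Qed.

Lemma connected_closed (A : pred G) :
  connected_graph G -> (forall u v, adj u v -> A u -> A v) ->
  forall u v, A u -> A v.
Proof.
move=> connG clA u v uA; have /connectP [p pp ->] := connG u v.
elim: p u uA pp => //= w p IHp u uA /andP [uw pp].
by apply: IHp pp; apply: clA uw uA.
Qed.

End Within.

(** * Adjacency and short walks after one step *)

Section Step.

Variables (G : sgraph) (clone : pred G).
Implicit Types (u v w x : G).

Let H := iim_step clone.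
Implicit Types h k : H.

Let old v : H := inl v.
Let copy v : H := inr v.

Definition base h : G := match h with inl v => v | inr v => v end.
(** Only anticlones are not [real]; the other vertices see all neighbors of their base. *)
Definition real h : bool := if h is inr v then clone v else true.

Lemma real_within h x : real h -> x \in cnbhd (base h) -> within 1 h (old x).
Proof.
case: h => v /= hr xv.
  move: xv; rewrite !inE => /orP [/eqP -> | vx]; first exact: within_refl.
  exact: within_adj.
by apply: within_adj; rewrite /= /copy_nbhd hr.
Qed.

Lemma old_within u x : x \in cnbhd u -> within 1 (old u) (old x).
Proof. exact: (@real_within (old u)). Qed.

Lemma real_adj h x : real h -> adj (base h) x -> adj h (old x).
Proof.
case: h => v //= hr xv.
by rewrite /copy_nbhd hr !inE xv orbT.
Qed.

Lemma anti_within v x : ~~ clone v -> x \notin cnbhd v -> within 1 (copy v) (old x).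
Proof.
by move=> /negPf cv xv; apply: within_adj; rewrite /= /copy_nbhd cv inE.
Qed.

Lemma cnbhd_sym u v : (u \in cnbhd v) = (v \in cnbhd u).
Proof. by rewrite !inE eq_sym adj_sym. Qed.

Lemma cnbhd_refl v : v \in cnbhd v.
Proof. by rewrite !inE eqxx. Qed.

Lemma adj_cnbhd u v : adj u v -> v \in cnbhd u.
Proof. by rewrite !inE orbC => ->. Qed.

Hint Resolve cnbhd_refl : core.

Hypothesis connH : connected_graph H.

(** Otherwise [copy v] would be isolated in the connected graph [H]. *)
Lemma anti_neighbor v : ~~ clone v -> exists x, x \notin cnbhd v.
Proof.
move=> cv; case: (pickP [pred x | x \notin cnbhd v]) => [x|none]; first by exists x.
suff : pred1 (copy v) (old v) by [].
apply: (@connected_closed _ (pred1 (copy v)) connH _ (copy v)); last exact: eqxx.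
move=> h k + /eqP hv; rewrite {h}hv; case: k => //= x.
by have := none x; rewrite /copy_nbhd (negPf cv) in_setC /= => ->.
Qed.

Lemma anti_within3 v a b : ~~ clone v -> a \in cnbhd v -> adj a b ->
  b \notin cnbhd v -> within 3 (old v) (copy v).
Proof.
move=> cv av ab bv; apply: (within_trans (m := 1) (n := 2)) (old_within av) _.
apply: (within_trans (m := 1) (n := 1)) (old_within (adj_cnbhd ab)) _.
exact/within_sym/anti_within.
Qed.

(** * An anticlone of [v] when the edge [l s] leaves [N[v]] *)

Section OpenAnticlone.

Variables v l s : G.
Hypotheses (cv : ~~ clone v) (vl : l \in cnbhd v) (ls : adj l s)
  (vs : s \notin cnbhd v).

(** Equivalently, [h] is an anticlone without common neighbor with [copy v]. *)
Definition far h : Prop :=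
  exists w, [/\ h = copy w, ~~ clone w & forall x, x \notin cnbhd v -> x \in cnbhd w].

Definition near_copy h : Prop :=
  exists2 x, x \notin cnbhd v & within 1 h (old x).

Lemma open_cases h : [\/ within 1 h (old v), near_copy h | far h].
Proof.
have [hr|] := boolP (real h).
  have [hv|hv] := boolP (base h \in cnbhd v).
    by constructor 1; apply: real_within => //; rewrite cnbhd_sym.
  by constructor 2; exists (base h) => //; apply: real_within.
case: h => //= w cw.
case: (pickP [pred x | x \notin cnbhd v & x \notin cnbhd w]) => [x /andP [xv xw]|none].
  by constructor 2; exists x => //; exact: anti_within.
constructor 3; exists w; split=> // x xv.
by have := none x; rewrite /= xv /= => /negbFE.
Qed.

Lemma near_copy_within h : near_copy h -> within 2 h (copy v).
Proof.
move=> [x xv hx]; apply: (within_trans (m := 1) (n := 1)) hx _.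
exact/within_sym/anti_within.
Qed.

Lemma far_within h : far h -> within 2 h (old v).
Proof.
move=> [w [-> cw vw]]; have [x xw] := anti_neighbor cw.
apply: (within_trans (m := 1) (n := 1)) (anti_within cw xw) _.
by apply/within_sym/old_within/negPn/negP => /vw; apply/negP.
Qed.

Lemma far_near_within h k : far h -> near_copy k -> within 5 h k.
Proof.
move=> [w [-> cw vw]] [y yv ky].
(* The walk goes from [copy w] to [old w] in 3 steps, then through [old y] to [k]. *)
suff ww : within 3 (old w) (copy w).
  apply: (within_trans (m := 3) (n := 2)) (within_sym ww) _.
  apply: (within_trans (m := 1) (n := 1)) (old_within (vw _ yv)) _.
  exact: within_sym.
have [x xw] := anti_neighbor cw.
have xv : x \in cnbhd v by apply/negPn/negP => /vw; apply/negP.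
(* Some edge leaves [N[w]] too: [s l] if [l] is outside, else [v x] or [l v] according to whether
   [v] is inside. *)
have [lw|lw] := boolP (l \in cnbhd w); last first.
  by apply: (anti_within3 cw (vw _ vs) _ lw); rewrite adj_sym.
have [v_w|v_w] := boolP (v \in cnbhd w).
  apply: (anti_within3 cw v_w _ xw); move: xv; rewrite !inE => /orP [/eqP xv|//].
  by rewrite xv v_w in xw.
apply: (anti_within3 cw lw _ v_w); move: vl; rewrite !inE adj_sym => /orP [/eqP lv|//].
by rewrite -lv lw in v_w.
Qed.

Lemma open_within h k : within 6 h k.
Proof.
have vv := anti_within3 cv vl ls vs.
(* The extremal case, 6 = 1 + 3 + 2: via [old v], then [copy v]. *)
have near_near a b : within 1 a (old v) -> near_copy b -> within 6 a b.
  move=> av bv; apply: (within_trans (m := 1) (n := 5)) av _.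
  by apply: (within_trans (m := 3) (n := 2)) vv _; apply/within_sym/near_copy_within.
have via_v a b : within 2 a (old v) -> within 2 b (old v) -> within 6 a b.
  move=> av bv; apply: (@within_le _ 4) => //.
  exact: (within_trans (m := 2) (n := 2)) av (within_sym bv).
have le2 a : within 1 a (old v) -> within 2 a (old v) by exact: within_le.
have [hv|hv|hv] := open_cases h; have [kv|kv|kv] := open_cases k.
- by apply: via_v; exact: le2.
- exact: near_near.
- by apply: via_v; [exact: le2 | exact: far_within].
- by apply/within_sym/near_near.
- apply: (@within_le _ 4) => //; apply: (within_trans (m := 2) (n := 2)).
    exact: near_copy_within hv.
  exact/within_sym/near_copy_within.
- by apply/within_sym/(@within_le _ 5)/far_near_within.
- by apply: via_v; [exact: far_within | exact: le2].
- exact/(@within_le _ 5)/far_near_within.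
- by apply: via_v; exact: far_within.
Qed.

End OpenAnticlone.

(** * Anticlones only of vertices [v] whose [N[v]] is a component *)

Section ClosedAnticlones.

Hypothesis closed : forall v a b,
  ~~ clone v -> a \in cnbhd v -> b \in cnbhd a -> b \in cnbhd v.

Lemma closed_third v : ~~ clone v -> exists w e,
  [/\ ~~ clone w, w \notin cnbhd v, e \notin cnbhd v & e \notin cnbhd w].
Proof.
move=> cv; case: (pickP [pred we : G * G | [&& ~~ clone we.1, we.1 \notin cnbhd v,
  we.2 \notin cnbhd v & we.2 \notin cnbhd we.1]]) => [[w e] /and4P [*]|none].
  by exists w, e.
(* Without such [w] and [e], no edge leaves [A], which consists of the real vertices over [N[v]] and
   the anticlones over its complement; it contains [old v] but not [copy v]. *)
pose A h := real h == (base h \in cnbhd v).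
suff : A (copy v) by rewrite /A /= (negPf cv) cnbhd_refl.
apply: (@connected_closed _ A connH _ (old v)); last by rewrite /A /= cnbhd_refl.
rewrite /A => -[] a [] x //=; rewrite /copy_nbhd.
- by move=> ax /eqP/esym av; rewrite (closed cv av) // adj_cnbhd.
- have [cx|cx] := boolP (clone x).
    by rewrite cnbhd_sym => xa /eqP/esym av; rewrite (closed cv av).
  rewrite in_setC => ax /eqP/esym av; apply/eqP/esym/negbTE.
  apply: contra ax; rewrite cnbhd_sym => vx.
  exact: closed cx vx av.
- have [ca|ca] := boolP (clone a).
    by move=> xa /eqP/esym av; rewrite (closed cv av).
  rewrite in_setC => xa /eqP/esym/negbT av; apply/eqP/esym/negPn/negP => xv.
  by have := none (a, x); rewrite /= ca av xv xa.
Qed.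

Lemma closed_within v h k : ~~ clone v -> within 6 h k.
Proof.
move=> cv; have [w [e [cw wv ev ew]]] := closed_third cv.
suff he a : within 3 a (old e).
  exact: (within_trans (m := 3) (n := 3)) (he h) (within_sym (he k)).
(* The anticlone [copy z] is a common neighbor of [old x] and [old e]. *)
have via z x : ~~ clone z -> x \notin cnbhd z -> e \notin cnbhd z ->
    within 2 (old x) (old e).
  move=> cz xz ez; apply: (within_trans (m := 1) (n := 1)).
    exact/within_sym/(anti_within cz xz).
  exact: anti_within.
have [ra|] := boolP (real a).
  apply: (within_trans (m := 1) (n := 2)) (real_within ra (cnbhd_refl _)) _.
  have [av|av] := boolP (base a \in cnbhd v); last exact: via av ev.
  apply: (via w) => //; apply: contra wv => aw.
  by apply: closed cv av _; rewrite cnbhd_sym.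
case: a => //= z cz; have [ez|ez] := boolP (e \in cnbhd z); last first.
  by apply: (@within_le _ 1) => //; exact: anti_within.
(* Here [N[z]] is the component of [e], so it misses [v]: the walk is [copy z], [old v], [copy w],
   [old e]. *)
apply: (within_trans (m := 1) (n := 2)) (via w v cw _ ew); last by rewrite cnbhd_sym.
apply: anti_within => //; apply: contra ev; rewrite cnbhd_sym => zv.
exact: closed cv zv ez.
Qed.

End ClosedAnticlones.

(** * Steps that only add clones *)

Section AllClones.

Hypothesis all_clone : forall v, clone v.

Lemma all_real h : real h.
Proof. by case: h => //= v; exact: all_clone. Qed.

Lemma all_clone_connected : connected_graph G.
Proof.
move=> u v; pose A h := connect (@adj G) u (base h).
apply: (@connected_closed _ A connH _ (old u) (old v)); last exact: connect0.
rewrite /A; suff base_adj a x : x \in cnbhd a -> connect (@adj G) u a -> connect (@adj G) u x.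
  move=> [] a [] x //=; rewrite /copy_nbhd ?all_clone.
  - by move/adj_cnbhd/base_adj.
  - by rewrite cnbhd_sym; apply: base_adj.
  - exact: base_adj.
rewrite !inE => /orP [/eqP -> //|ax] ua.
exact: connect_trans ua (connect1 ax).
Qed.

Lemma real_path h x p :
  path (@adj G) (base h) (x :: p) -> within (size p).+1 h (old (last x p)).
Proof.
elim: p h x => [|y p IHp] h x /= /andP [hx xp].
  exact/within_adj/real_adj/hx/all_real.
apply: (within_trans (m := 1)) (IHp (old x) y xp).
exact/within_adj/real_adj/hx/all_real.
Qed.

(** Inner vertices lift to old ones. The 2 accounts for copies of adjacent vertices, which are not
    adjacent themselves. *)
Lemma lift_within n h k : within n (base h) (base k) -> within (maxn n 2) h k.
Proof.
have adj_last x : adj x (base k) -> within 1 (old x) k.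
  by move=> xk; apply/within_sym/within_adj/real_adj; rewrite ?all_real // adj_sym.
have at_base a : within 1 a (old (base a)) by apply: real_within; rewrite ?all_real.
have le2 : within 2 h k -> within (maxn n 2) h k.
  exact/within_le/leq_maxr.
case; elim/last_ind => [_ [/= hk _]|p x _].
  apply: le2; apply: (within_trans (m := 1) (n := 1)) (at_base h) _.
  by rewrite hk; apply: within_sym.
rewrite last_rcons rcons_path size_rcons => /andP [pp px] [xk sp].
rewrite {x}xk in px; case: p pp px sp => [_ hk _|x p pp px sp].
  by apply: le2; apply: (within_trans (m := 1) (n := 1)) (at_base h) (adj_last _ hk).
apply: (@within_le _ (size p).+2); first by rewrite leq_max sp.
rewrite -addn1; apply: within_trans (real_path pp) _.
exact: adj_last.
Qed.

End AllClones.

Lemma diam_step :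
  (diam H <= (Posz 6)%:E)%E \/
  connected_graph G /\ (diam H <= Order.max (diam G) (Posz 6)%:E)%E.
Proof.
case: (pickP [pred v | ~~ clone v]) => [v0 /= cv0|all_c]; last first.
  have {}all_c v : clone v by have := all_c v => /= /negbFE.
  right; split; first exact: all_clone_connected.
  apply: diam_le => h k.
  have [n hk dn] := within_dist (all_clone_connected all_c (base h) (base k)).
  apply: le_trans (dist_le (lift_within all_c hk)) _.
  rewrite le_max; have [n2|n2] := leqP n 2; first by rewrite orbC lee_fin.
  by rewrite -dn dist_le_diam.
left; apply: diam_le => h k; apply: dist_le.
(* Either an edge leaves [N[v]] for some anticlone of a vertex [v], or every such [N[v]] is closed
   under adjacency. *)
have [/existsP [[v [l s]] /= /and4P []]|none] := boolP [exists t : G * (G * G),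
  [&& ~~ clone t.1, t.2.1 \in cnbhd t.1, adj t.2.1 t.2.2 & t.2.2 \notin cnbhd t.1]].
  by move=> cv vl ls vs; exact: open_within cv vl ls vs h k.
apply: (@closed_within _ v0) => // v a b cv av.
rewrite {1}in_setU1 in_set => /orP [/eqP -> //|ab].
apply: contraR none => bv; apply/existsP; exists (v, (a, b)).
by rewrite /= cv av ab.
Qed.

End Step.

Theorem corollary4p2 (G : sgraph) (l : nat) (H : sgraph)
  (iimH : IIM G l H) (connH : connected_graph H) :
  (diam H <= Order.max (diam G) (Posz 6)%:E)%E.
Proof.
elim: iimH connH => [|{H}l H clone _ IH] connH; first by rewrite le_max lexx.
have [le6|[connG leG]] := diam_step connH; first by rewrite le_max le6 orbT.
by apply: le_trans leG _; rewrite ge_max IH // le_max lexx orbT.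
Qed.
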